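(* Let $q\ge 2$ be an integer and let $G$ be a finite group with $\Gamma^q(G)\neq 1$. Let $\mu_q$ be the M\''obius function of the poset $\mathcal{L}_q(G)=\mathcal{N}_q(G)\cup\{G\}$. Then for every integer $s\ge 1$, $$P_q(G,s)=-\sum_{A\in \mathcal{N}_q(G)} \frac{\mu_q(A,G)}{|G:A|^s}.$$
   Context: The lower central series of a group $K$ is $\Gamma^1(K)=K$, $\Gamma^q(K)=[\Gamma^{q-1}(K),K]$. A group $H$ is nilpotent of class less than $q$ when $\Gamma^q(H)=1$. $\mathcal{N}_q(G)$ is the poset, ordered by inclusion, of all proper subgroups $H$ of $G$ with $\Gamma^q(H)=1$. $P_q(G,s)$ is the probability that a randomly chosen ordered $s$-tuple generates a nilpotent subgroup of class less than $q$: $P_q(G,s)=|\{(g_1,\ldots,g_s)\in G^s : \Gamma^q(\langle g_1,\ldots,g_s\rangle)=1\}|/|G|^s$. The M\''obius function $\mu$ of a finite poset $\mathcal{X}$ is the integer-valued function determined by $\mu(a,a)=1$ and $\mu(a,b)=-\sum_{a\le u<b}\mu(a,u)$ for $a<b$. *)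

(* Defs.v *)
From HB Require Import structures.
From mathcomp Require Import all_boot all_order all_algebra.
From mathcomp Require Import all_fingroup all_solvable.

Set Implicit Arguments.
Unset Strict Implicit.
Unset Printing Implicit Defensive.

Import GRing.Theory.
Local Open Scope ring_scope.

Section Mobius.

Variables (T : finType) (le : rel T) (X : {set T}).

(* Moebius function of the finite poset (X, le): the recursion runs on a fuel  *)
(* n, and #|X|.+1 is always enough; the defining equations are mobius_refl and *)
(* mobius_lt below.                                                            *)
Fixpoint mobius_rec (n : nat) (a b : T) : int :=
  if n is n'.+1 then
    if a == b then 1
    else if le a b then
      - \sum_(u in X | [&& le a u, le u b & u != b]) mobius_rec n' a u
    else 0
  else 0.

Definition mobius (a b : T) : int := mobius_rec #|X|.+1 a b.

Lemma mobius_refl a : mobius a a = 1.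
Proof. by rewrite /mobius /= eqxx. Qed.

Hypotheses (le_anti : antisymmetric le) (le_trans : transitive le).

Let below b := [set u in X | le u b & u != b].

Let mobius_rec_fuel a n m b :
  (#|below b| < n)%N -> (#|below b| < m)%N ->
  mobius_rec n a b = mobius_rec m a b.
Proof.
elim: n m b => [|n IHn] [|m] b //= ltn ltm.
case: eqP => // _; case: ifP => // _; congr (- _).
apply: eq_bigr => u /and4P[uX _ leub neub].
have lt_below: (#|below u| < #|below b|)%N.
  apply/proper_card/properP; split.
    apply/subsetP => v; rewrite !inE => /and3P[-> levu nevu] /=.
    rewrite (le_trans levu leub) /=; apply/eqP => evb.
    by move: neub; rewrite (@le_anti u b) ?eqxx // leub -evb levu.
  by exists u; rewrite !inE uX ?leub ?neub // eqxx andbF.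
by apply: IHn; apply: leq_trans lt_below _; rewrite -ltnS.
Qed.

Lemma mobius_lt a b : le a b -> a != b ->
  mobius a b = - \sum_(u in X | [&& le a u, le u b & u != b]) mobius a u.
Proof.
move=> leab neab; have le_below c : (#|below c| < #|X|.+1)%N.
  by rewrite ltnS subset_leq_card //; apply/subsetP => u; rewrite inE => /andP[].
transitivity (mobius_rec #|X|.+2 a b).
  by apply: mobius_rec_fuel; [exact: le_below | exact: ltnW (le_below b)].
by rewrite [LHS]/= (negPf neab) leab.
Qed.

End Mobius.

Section NilpotentSubgroups.

Variable gT : finGroupType.
Implicit Types (q s : nat) (G : {group gT}).

(* 'L_1(H) = H, so 'L_q(H) is the term Gamma^q(H) for q >= 1. *)
Definition nilp_proper_subgroups q G : {set {group gT}} :=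
  [set H : {group gT} | (H \proper G) && ('L_q(H)%g == 1%g)].

Definition nilp_poset q G : {set {group gT}} := G |: nilp_proper_subgroups q G.

Definition subgroup_le : rel {group gT} := fun H K => H \subset K.

Definition mobius_nilp q G : {group gT} -> {group gT} -> int :=
  mobius subgroup_le (nilp_poset q G).

Definition prob_nilp q G s : rat :=
  #|[set t : s.-tuple gT |
       all [in G] t && ('L_q(<<[set x in t]>>)%g == 1%g)]|%:R
  / #|G|%:R ^+ s.

Lemma mobius_nilp_refl q G (A : {group gT}) : mobius_nilp q G A A = 1.
Proof. exact: mobius_refl. Qed.

Lemma mobius_nilp_lt q G (A B : {group gT}) : A \proper B ->
  mobius_nilp q G A B =
  - \sum_(U in nilp_poset q G | (A \subset U) && (U \proper B))
      mobius_nilp q G A U.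
Proof.
have properE (H K : {group gT}) : H \proper K = (H \subset K) && (H != K).
  by rewrite properEneq andbC.
rewrite properE => /andP[sAB neAB].
rewrite {1}/mobius_nilp mobius_lt //.
- by congr (- _); apply: eq_bigl => U; rewrite properE.
- by move=> H K sHK; apply/val_inj/eqP; rewrite eqEsubset.
- by move=> K H L; apply: subset_trans.
Qed.

End NilpotentSubgroups.

(* Main.v *)
Require Import Defs.
From mathcomp Require Import all_boot all_order all_algebra.
From mathcomp Require Import all_fingroup all_solvable.

(** Write K(t) for the subgroup generated by a tuple t.  Since #|A| ^ s counts
    the s-tuples t with K(t) \subset A, multiplying the right-hand side by
    #|G| ^ s and exchanging sums turns it into a sum over all tuples t of
      - \sum_(A nilpotent proper, K(t) \subset A) mu(A, G),
    and it suffices that this equals 1 when t counts for the probability and 0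
    otherwise ([sum_mobius_nilp_over]).  If K(t) is not in N_q(G), no member of
    N_q(G) contains it, because the lower central series is monotone.  If it
    is, the sum is mu(G, G) = 1 minus the sum of mu(A, G) over the whole
    interval from K(t) to G in the poset, and that last sum vanishes.

    The vanishing is a summation over the lower argument of mu, whereas mu is
    defined by a recursion on its upper argument.  The two are related by
    [mobius_dual]: the Moebius function of the opposite order is mu with its
    arguments exchanged, i.e. a left inverse of the zeta function is also a
    right inverse. *)

Local Open Scope ring_scope.
Import GRing.Theory.

Section MobiusDuality.

Variables (T : finType) (le : rel T) (X : {set T}).
Hypotheses (le_refl : reflexive le) (le_anti : antisymmetric le).
Hypothesis le_trans : transitive le.

(** The identity mu * zeta = 1 of the incidence algebra: the defining recursion
    of mu, with the term of the upper end moved to the same side. *)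
Lemma sum_mobius_upper a b : b \in X ->
  \sum_(u in X | le a u && le u b) mobius le X a u = (a == b)%:R.
Proof.
move=> bX; case: (boolP (le a b)) => [leab | nleab]; last first.
  rewrite big_pred0 => [|u]; last first.
    by apply/negP => /and3P[_ leau /(le_trans _ _ _ leau)]; apply/negP.
  by case: eqP nleab => // ->; rewrite le_refl.
rewrite (bigD1 b) /=; last by rewrite bX leab le_refl.
case: eqP => [-> | /eqP neab].
  rewrite mobius_refl big_pred0 ?addr0 // => u; apply/negP.
  by case/andP=> /and3P[_ lebu leub] /eqP[]; apply: le_anti; rewrite leub.
rewrite (mobius_lt X le_anti le_trans) // addrC.
rewrite (eq_bigl (fun u => (u \in X) && [&& le a u, le u b & u != b])).
  by rewrite subrr.
by move=> u; rewrite !andbA.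
Qed.

End MobiusDuality.

(** In the incidence algebra, mu * zeta = 1 and zeta * nu = 1, where nu is the
    Moebius function of the opposite order with exchanged arguments; hence
    mu = mu * (zeta * nu) = (mu * zeta) * nu = nu. *)
Lemma mobius_dual (T : finType) (le : rel T) (X : {set T}) (a b : T) :
    reflexive le -> antisymmetric le -> transitive le -> a \in X -> b \in X ->
  mobius (fun x y => le y x) X b a = mobius le X a b.
Proof.
move=> le_refl le_anti le_trans aX bX.
pose ge x y := le y x; rewrite -/ge.
have ge_anti : antisymmetric ge by move=> x y /andP[leyx lexy]; apply/le_anti/andP.
have ge_trans : transitive ge by move=> y x z leyx lezy; apply: le_trans leyx.
have outside x y : ~~ le x y -> mobius le X x y = 0.
  by rewrite /mobius /=; case: eqP => [->|_ /negPf-> //]; rewrite le_refl.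
have outside' x y : ~~ ge x y -> mobius ge X x y = 0.
  by rewrite /mobius /=; case: eqP => [->|_ /negPf-> //]; rewrite /ge le_refl.
have sumX (F : T -> int) c : c \in X -> \sum_(u in X) F u * (u == c)%:R = F c.
  move=> cX; rewrite (bigD1 c) //= eqxx mulr1 big1 ?addr0 // => u.
  by case/andP=> _ /negPf->; rewrite mulr0.
(* the double sum is ((mu * zeta) * nu)(a, b); its range need not mention the
   order because mu and nu vanish outside it *)
transitivity (\sum_(u in X) \sum_(v in X)
    mobius le X a u * (le u v)%:R * mobius ge X b v).
  rewrite exchange_big /= -(sumX (mobius ge X b) a aX); apply: eq_bigr => v vX.
  rewrite -mulr_suml mulrC; congr (_ * _); rewrite eq_sym.
  rewrite -(sum_mobius_upper _ _ _ le_refl le_anti le_trans a v vX).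
  rewrite big_mkcondr; apply: eq_bigr => u _.
  case: (boolP (le a u)) => [_|/outside->]; last by rewrite mul0r.
  by case: (le u v); rewrite ?mulr1 ?mulr0.
rewrite -(sumX (mobius le X a) b bX); apply: eq_bigr => u uX.
under eq_bigr do rewrite -mulrA; rewrite -mulr_sumr; congr (_ * _).
rewrite eq_sym -(sum_mobius_upper _ ge _ le_refl ge_anti ge_trans b u uX).
rewrite [RHS]big_mkcondr; apply: eq_bigr => v _.
case: (boolP (ge b v)) => [_|/outside'->]; last by rewrite mulr0.
by rewrite /ge; case: (le u v); rewrite ?mul1r ?mul0r.
Qed.

(** The identity zeta * mu = 1: by duality, it is [sum_mobius_upper] read in the
    opposite order. *)
Lemma sum_mobius_lower (T : finType) (le : rel T) (X : {set T}) (a b : T) :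
    reflexive le -> antisymmetric le -> transitive le -> a \in X -> b \in X ->
  \sum_(u in X | le a u && le u b) mobius le X u b = (a == b)%:R.
Proof.
move=> le_refl le_anti le_trans aX bX; pose ge x y := le y x.
have ge_anti : antisymmetric ge by move=> x y /andP[leyx lexy]; apply/le_anti/andP.
have ge_trans : transitive ge by move=> y x z leyx lezy; apply: le_trans leyx.
rewrite eq_sym -(sum_mobius_upper _ ge _ le_refl ge_anti ge_trans b a aX).
apply: eq_big => [u | u /andP[uX _]]; first by rewrite [ge b u && _]andbC.
by rewrite mobius_dual.
Qed.

Lemma nilp_proper_subgroupsS (gT : finGroupType) (q : nat)
    (G H K : {group gT}) :
    H \subset K -> K \in nilp_proper_subgroups q G ->
  H \in nilp_proper_subgroups q G.
Proof.
move=> sHK; rewrite !inE => /andP[prKG /eqP LK1].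
rewrite (sub_proper_trans sHK prKG) -subG1 -LK1.
exact: lcnS.
Qed.

(** For K in N_q(G), the interval from K to G in the poset consists of G and the
    members of N_q(G) above K, and mu(-, G) sums to 0 over it; moving away the
    term mu(G, G) = 1 leaves -1.  Otherwise the sum is empty, N_q(G) being closed
    under passing to subgroups. *)
Lemma sum_mobius_nilp_over (gT : finGroupType) (q : nat) (G K : {group gT}) :
  \sum_(A in nilp_proper_subgroups q G | K \subset A) mobius_nilp q G A G
    = - (K \in nilp_proper_subgroups q G)%:R.
Proof.
case: (boolP (K \in _)) => [NK | notNK]; last first.
  rewrite big_pred0 ?oppr0 // => A; apply/negP=> /andP[NA sKA].
  by case/negP: notNK; apply: nilp_proper_subgroupsS NA.
have sKG : K \subset G by move: NK; rewrite inE => /andP[/proper_sub].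
have notNG : G \notin nilp_proper_subgroups q G by rewrite inE properxx.
have neKG : (K == G) = false by case: eqP NK => // ->; rewrite (negPf notNG).
have GX : G \in nilp_poset q G by rewrite setU11.
have KX : K \in nilp_poset q G by rewrite setU1r.
have le_anti : antisymmetric (@subgroup_le gT).
  by move=> H L sHL; apply/val_inj/eqP; rewrite eqEsubset.
have le_trans : transitive (@subgroup_le gT) by move=> H L M; apply: subset_trans.
have le_refl : reflexive (@subgroup_le gT) by move=> H; apply: subxx.
have := sum_mobius_lower _ _ _ _ _ le_refl le_anti le_trans KX GX.
rewrite neKG (bigD1 G) /=; last by rewrite GX /subgroup_le sKG subxx.
rewrite mobius_refl => /eqP; rewrite addrC addr_eq0 => /eqP <-.
apply: eq_bigl => A; rewrite in_setU1 /subgroup_le.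
case: (eqVneq A G) => [->|neAG]; first by rewrite (negPf notNG) andbF.
rewrite andbT /=; case NA: (A \in _) => //=.
by move: NA; rewrite inE => /andP[/proper_sub-> _]; rewrite andbT.
Qed.

Lemma card_tuple_in (T : finType) (A : {set T}) (s : nat) :
  #|[set t : s.-tuple T | all [in A] t]| = (#|A| ^ s)%N.
Proof.
rewrite -[in RHS](card_ord s) -card_ffun_on -[RHS]cardsE.
pose f (t : s.-tuple T) := [ffun i => tnth t i].
pose g (h : {ffun 'I_s -> T}) := [tuple h i | i < s].
have fK : cancel f g by move=> t; apply: eq_from_tnth => i; rewrite tnth_mktuple ffunE.
have gK : cancel g f by move=> h; apply/ffunP => i; rewrite ffunE tnth_mktuple.
rewrite -(card_imset _ (can_inj fK)); apply: eq_card => h.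
rewrite (can2_imset_pre _ fK gK) !inE.
apply/all_tnthP/ffun_onP => hA i; move: (hA i); by rewrite tnth_mktuple.
Qed.

Lemma gen_tuple_subG (gT : finGroupType) (A : {group gT}) (s : nat)
    (t : s.-tuple gT) :
  (<<[set x in t]>> \subset A)%g = all [in A] t.
Proof.
rewrite gen_subG; apply/subsetP/allP => sub x; first by move=> xt; rewrite sub ?inE.
by rewrite inE => /sub.
Qed.

Lemma card_nilp_tuples (gT : finGroupType) (G : {group gT}) (q s : nat) :
    'L_q(G)%g <> 1%g ->
  #|[set t : s.-tuple gT |
       all [in G] t && ('L_q(<<[set x in t]>>)%g == 1%g)]|%:R
    = - \sum_(A in nilp_proper_subgroups q G)
          mobius_nilp q G A G * (#|A| ^ s)%:R :> int.
Proof.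
move=> LG; pose K (t : s.-tuple gT) := <<[set x in t]>>%G.
transitivity (\sum_t (K t \in nilp_proper_subgroups q G)%:R : int).
  rewrite -sum1_card natr_sum big_mkcond; apply: eq_bigr => t _.
  rewrite !inE -gen_tuple_subG properEneq /=.
  (* properness of <<t>> is automatic when its 'L_q is trivial, that of G not
     being so *)
  case: (eqVneq <<[set x in t]>>%g (G : {set gT})) => [->|_] /=; last by case: ifP.
  by case: eqP LG => //; rewrite andbF.
rewrite -[LHS]opprK -sumrN; congr (- _).
under eq_bigr do rewrite -sum_mobius_nilp_over big_mkcondr.
rewrite exchange_big; apply: eq_bigr => A _ /=.
rewrite -card_tuple_in -big_mkcond sumr_const mulr_natr.
by congr (_ *+ _); apply: eq_card => t; rewrite !inE -gen_tuple_subG.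
Qed.

Theorem proposition4p2 (gT : finGroupType) (G : {group gT}) (q : nat)
    (hq : (2 <= q)%N) (hG : 'L_q(G)%g <> 1%g) (s : nat) (hs : (1 <= s)%N) :
  prob_nilp q G s =
  - \sum_(A in nilp_proper_subgroups q G)
      (mobius_nilp q G A G)%:~R / #|G : A|%g%:R ^+ s.
Proof.
rewrite /prob_nilp -[X in X / _]mulrz_nat card_nilp_tuples // rmorphN /= mulNr.
congr (- _); rewrite rmorph_sum /= mulr_suml; apply: eq_bigr => A.
rewrite inE => /andP[/proper_sub sAG _].
have nz (B : {group gT}) : #|B|%:R != 0 :> rat.
  by rewrite Num.Theory.pnatr_eq0 -lt0n cardG_gt0.
rewrite rmorphM /= mulrz_nat natrX -mulrA -(Lagrange sAG) natrM exprMn.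
by rewrite invfM mulVKf ?expf_neq0.
Qed.
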